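(* Let $\mathcal E$ be an (axiomatic) extension of the logic $\mathcal{DHMSH}$. The Deduction Property holds in $\mathcal E$ for the connective $\to_H$ if and only if $\vdash_{\mathcal E}(\alpha\to_H\beta)\to_H({\sim}\beta\to_H{\sim}\alpha)$ (for all formulas $\alpha,\beta$).
   Context: Language: $\langle\vee,\wedge,\to,\sim,\bot,\top\rangle$ of arities $2,2,2,1,0,0$; formulas are built over a countably infinite set of propositional variables. The abbreviation $\alpha\to_H\beta$ stands for $\alpha\to(\alpha\wedge\beta)$. The logic $\mathcal{DHMSH}$ is the Hilbert-style logic with axiom schemes: (A1) $\alpha\to_H(\alpha\vee\beta)$; (A2) $\beta\to_H(\alpha\vee\beta)$; (A3) $(\alpha\to_H\gamma)\to_H[(\beta\to_H\gamma)\to_H((\alpha\vee\beta)\to_H\gamma)]$; (A4) $(\alpha\wedge\beta)\to_H\alpha$; (A5) $(\gamma\to_H\alpha)\to_H[(\gamma\to_H\beta)\to_H(\gamma\to_H(\alpha\wedge\beta))]$; (A6) $\top$; (A7) $\bot\to_H\alpha$; (A8) $((\alpha\wedge\beta)\to_H\gamma)\to_H(\alpha\to_H(\beta\to_H\gamma))$; (A9) $(\alpha\to_H(\beta\to_H\gamma))\to_H((\alpha\wedge\beta)\to_H\gamma)$; (A10) $(\alpha\to_H\beta)\to_H((\beta\to_H\alpha)\to_H((\alpha\to\gamma)\to_H(\beta\to\gamma)))$; (A11) $(\alpha\to_H\beta)\to_H((\beta\to_H\alpha)\to_H((\gamma\to\beta)\to_H(\gamma\to\alpha)))$; (A12) $\top\to_H{\sim}\bot$;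 (A13) ${\sim}\top\to_H\bot$; (A14) ${\sim}(\alpha\wedge\beta)\to_H({\sim}\alpha\vee{\sim}\beta)$; and rules (SMP): from $\phi$ and $\phi\to_H\gamma$ deduce $\gamma$; (SCP): from $\phi\to_H\gamma$ deduce ${\sim}\gamma\to_H{\sim}\phi$. $\Gamma\vdash\phi$ means that $\phi$ is derivable from axioms and members of $\Gamma$ by these rules (both rules may be applied to any formulas already derived from $\Gamma$). An axiomatic extension is obtained by adjoining new axiom schemes and keeping the same rules. A logic $\mathcal L$ has the Deduction Property for a binary connective $\Rightarrow$ if for all sets of formulas $\Gamma\cup\{\alpha,\beta\}$: $\Gamma,\alpha\vdash_{\mathcal L}\beta$ if and only if $\Gamma\vdash_{\mathcal L}\alpha\Rightarrow\beta$. *)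

(* Defs.v *)
From Stdlib Require Export Ensembles.

Set Implicit Arguments.

Inductive formula : Type :=
  | Var (n : nat)
  | Or (a b : formula)
  | And (a b : formula)
  | Imp (a b : formula)
  | Neg (a : formula)
  | Bot
  | Top.

Declare Scope dhmsh_scope.
Delimit Scope dhmsh_scope with dhmsh.
Bind Scope dhmsh_scope with formula.

Definition ImpH (a b : formula) : formula := Imp a (And a b).

Notation "a ∧' b" := (And a b) (at level 40, left associativity) : dhmsh_scope.
Notation "a ∨' b" := (Or a b) (at level 50, left associativity) : dhmsh_scope.
Notation "a →' b" := (Imp a b) (at level 55, right associativity) : dhmsh_scope.
Notation "a →H b" := (ImpH a b) (at level 55, right associativity) : dhmsh_scope.
Notation "~' a" := (Neg a) (at level 35, right associativity) : dhmsh_scope.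

Local Open Scope dhmsh_scope.

Fixpoint subst (s : nat -> formula) (f : formula) : formula :=
  match f with
  | Var n => s n
  | Or a b => Or (subst s a) (subst s b)
  | And a b => And (subst s a) (subst s b)
  | Imp a b => Imp (subst s a) (subst s b)
  | Neg a => Neg (subst s a)
  | Bot => Bot
  | Top => Top
  end.

Inductive dhmsh_axiom : formula -> Prop :=
  | A1 a b : dhmsh_axiom (a →H (a ∨' b))
  | A2 a b : dhmsh_axiom (b →H (a ∨' b))
  | A3 a b c :
      dhmsh_axiom ((a →H c) →H ((b →H c) →H ((a ∨' b) →H c)))
  | A4 a b : dhmsh_axiom ((a ∧' b) →H a)
  | A5 a b c :
      dhmsh_axiom ((c →H a) →H ((c →H b) →H (c →H (a ∧' b))))
  | A6 : dhmsh_axiom Top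
  | A7 a : dhmsh_axiom (Bot →H a)
  | A8 a b c :
      dhmsh_axiom (((a ∧' b) →H c) →H (a →H (b →H c)))
  | A9 a b c :
      dhmsh_axiom ((a →H (b →H c)) →H ((a ∧' b) →H c))
  | A10 a b c :
      dhmsh_axiom ((a →H b) →H ((b →H a) →H ((a →' c) →H (b →' c))))
  | A11 a b c :
      dhmsh_axiom ((a →H b) →H ((b →H a) →H ((c →' b) →H (c →' a))))
  | A12 : dhmsh_axiom (Top →H ~' Bot)
  | A13 : dhmsh_axiom (~' Top →H Bot)
  | A14 a b : dhmsh_axiom (~' (a ∧' b) →H (~' a ∨' ~' b)).

(* [derives S G f]: f is derivable from G in the axiomatic extension of DHMSH
   obtained by adjoining the formulas in S as axiom schemes; the variables of
   a formula in S play the role of metavariables, so that all its substitution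
   instances are axioms. DHMSH itself is the case where S is empty. *)
Inductive derives (S G : Ensemble formula) : formula -> Prop :=
  | derives_axiom f : dhmsh_axiom f -> derives S G f
  | derives_scheme s f : In formula S f -> derives S G (subst s f)
  | derives_hyp f : In formula G f -> derives S G f
  | derives_SMP f g :
      derives S G f -> derives S G (f →H g) -> derives S G g
  | derives_SCP f g :
      derives S G (f →H g) -> derives S G (~' g →H ~' f).

(* A logic is represented by its consequence relation. *)
Definition deduction_property
    (L : Ensemble formula -> formula -> Prop)
    (imp : formula -> formula -> formula) : Prop :=
  forall (G : Ensemble formula) (a b : formula),
    L (Add formula G a) b <-> L G (imp a b).

(* Main.v *)
Require Import Defs.
Local Open Scope dhmsh_scope.

Set Implicit Arguments.

(** If the Deduction Property holds, then (SCP) applied to the single premise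
    [a →H b] gives [~' b →H ~' a], and discharging that premise gives the
    stated scheme. Conversely, given the scheme, [a →H f] is derived from [G] by
    induction on the derivation of [f] from [G] and [a]: (SMP) is handled by the
    rule from [a →H f] and [a →H (f →H g)] to [a →H g], and (SCP) by composing
    [a →H (f →H g)] with the scheme.

    The work lies in these two rules for [→H], because the axioms contain
    neither [a →H a] nor [(a ∧' b) →H b]. Call a formula [a] reflexive when
    [a →H a] is derivable, and call two formulas interderivable when each
    implies the other through [→H]. Since [a →H b] unfolds to [a →' (a ∧' b)],
    (A10) and (A11) allow the replacement of interderivable formulas on either
    side of [→H], on the left under a side condition that holds when the
    conclusion is reflexive ([derives_replace_r], [derives_replace_l]). This
    gives composition and modus ponens under an antecedent for reflexive
    formulas ([derives_trans_of_refl], [derives_MP_under_of_refl]).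

    It remains to show that every formula [a] is reflexive ([derives_refl]).
    By (A10) and (A11), an implication [b →' c] is reflexive as soon as [b] or
    [c] is. Now [Top] is reflexive, and so is [a ∧' a] because
    [(a ∧' a) →H a]. Hence [Top →H a], which is [Top →' (Top ∧' a)], and
    [a →H a], which is [a →' (a ∧' a)], are themselves reflexive, and the rules
    above apply to them. With (A10) they give [(Top →H a) →H (a →H a)]. Uncurried,
    this supplies the side conditions needed to pass from [((Top →H a) ∧' Top) →H a] to
    [(Top →H a) →H a]. As [a →H (Top →H a)] also holds, [a] is interderivable
    with another formula, and is therefore reflexive. *)

(** * Conjunction and weakening *)

Lemma derives_K (S G : Ensemble formula) (a b : formula) :
  derives S G b -> derives S G (a →H b).
Proof.
  intro H. apply (derives_SMP H).
  refine (derives_SMP _ (derives_axiom S G (A8 b a b))).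
  exact (derives_axiom S G (A4 b a)).
Qed.

Lemma derives_uncurry (S G : Ensemble formula) (a b c : formula) :
  derives S G (a →H (b →H c)) -> derives S G ((a ∧' b) →H c).
Proof.
  intro H. exact (derives_SMP H (derives_axiom S G (A9 a b c))).
Qed.

Lemma derives_and_l (S G : Ensemble formula) (a b : formula) :
  derives S G ((a ∧' b) →H a).
Proof. exact (derives_axiom S G (A4 a b)). Qed.

Lemma derives_weaken_l (S G : Ensemble formula) (a b c : formula) :
  derives S G (b →H c) -> derives S G ((a ∧' b) →H c).
Proof. intro H. apply derives_uncurry. apply derives_K. exact H. Qed.

Lemma derives_and_intro (S G : Ensemble formula) (a b c : formula) :
  derives S G (c →H a) -> derives S G (c →H b) ->
  derives S G (c →H (a ∧' b)).
Proof.
  intros Ha Hb. apply (derives_SMP Hb).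
  exact (derives_SMP Ha (derives_axiom S G (A5 a b c))).
Qed.

(** * Replacement of interderivable formulas *)

Lemma derives_Imp_cong_l (S G : Ensemble formula) (a b c : formula) :
  derives S G (a →H b) -> derives S G (b →H a) ->
  derives S G ((a →' c) →H (b →' c)).
Proof.
  intros Hab Hba. apply (derives_SMP Hba).
  exact (derives_SMP Hab (derives_axiom S G (A10 a b c))).
Qed.

Lemma derives_Imp_cong_r (S G : Ensemble formula) (a b c : formula) :
  derives S G (a →H b) -> derives S G (b →H a) ->
  derives S G ((c →' a) →H (c →' b)).
Proof.
  intros Hab Hba. apply (derives_SMP Hab).
  exact (derives_SMP Hba (derives_axiom S G (A11 b a c))).
Qed.

(** [p ∧' a] and [p ∧' b] are interderivable, so [p →' (p ∧' a)] can be turned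
    into [p →' (p ∧' b)]. *)
Lemma derives_replace_r (S G : Ensemble formula) (a b p : formula) :
  derives S G (a →H b) -> derives S G (b →H a) ->
  derives S G (p →H a) -> derives S G (p →H b).
Proof.
  intros Hab Hba Hpa. apply (derives_SMP Hpa).
  apply (@derives_Imp_cong_r S G (p ∧' a) (p ∧' b) p).
  - apply derives_and_intro; [apply derives_and_l |].
    apply derives_weaken_l. exact Hab.
  - apply derives_and_intro; [apply derives_and_l |].
    apply derives_weaken_l. exact Hba.
Qed.

Lemma derives_refl_of_equiv (S G : Ensemble formula) (a b : formula) :
  derives S G (a →H b) -> derives S G (b →H a) -> derives S G (a →H a).
Proof.
  intros Hab Hba. exact (derives_replace_r Hba Hab Hab).
Qed.

(** Turning [a →' (a ∧' c)] into [b →' (b ∧' c)] replaces both occurrences of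
    [a]; for the second one, [a ∧' c] and [b ∧' c] have to be interderivable,
    whence the two premises on [c]. *)
Lemma derives_replace_l (S G : Ensemble formula) (a b c : formula) :
  derives S G (a →H b) -> derives S G (b →H a) ->
  derives S G ((a ∧' c) →H c) -> derives S G ((b ∧' c) →H c) ->
  derives S G (a →H c) -> derives S G (b →H c).
Proof.
  intros Hab Hba Ha Hb Hac.
  assert (Hb' : derives S G (b →' (a ∧' c))).
  { exact (derives_SMP Hac (derives_Imp_cong_l (a ∧' c) Hab Hba)). }
  apply (derives_SMP Hb').
  apply (@derives_Imp_cong_r S G (a ∧' c) (b ∧' c) b).
  - apply derives_and_intro; [| exact Ha].
    exact (derives_replace_r Hab Hba (derives_and_l S G a c)).
  - apply derives_and_intro; [| exact Hb].
    exact (derives_replace_r Hba Hab (derives_and_l S G b c)).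
Qed.

(** * Reflexive formulas *)

(** In a premise [a ∧' b] with [a] reflexive, a conjunct [b] implied by [a] can
    be dropped if the conclusion is reflexive: [a] and [a ∧' b] are
    interderivable. *)
Lemma derives_drop_of_refl (S G : Ensemble formula) (a b c : formula) :
  derives S G (a →H a) -> derives S G (c →H c) ->
  derives S G (a →H b) -> derives S G ((a ∧' b) →H c) ->
  derives S G (a →H c).
Proof.
  intros Ha Hc Hab H.
  refine (derives_replace_l (derives_and_l S G a b) _ _ _ H).
  - exact (derives_and_intro Ha Hab).
  - apply derives_weaken_l. exact Hc.
  - apply derives_weaken_l. exact Hc.
Qed.

Lemma derives_trans_of_refl (S G : Ensemble formula) (a b c : formula) :
  derives S G (a →H a) -> derives S G (c →H c) ->
  derives S G (a →H b) -> derives S G (b →H c) -> derives S G (a →H c).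
Proof.
  intros Ha Hc Hab Hbc. apply (derives_drop_of_refl Ha Hc Hab).
  apply derives_weaken_l. exact Hbc.
Qed.

Lemma derives_MP_under_of_refl (S G : Ensemble formula) (a b c : formula) :
  derives S G (a →H a) -> derives S G (c →H c) ->
  derives S G (a →H b) -> derives S G (a →H (b →H c)) ->
  derives S G (a →H c).
Proof.
  intros Ha Hc Hab Habc. apply (derives_drop_of_refl Ha Hc Hab).
  apply derives_uncurry. exact Habc.
Qed.

Lemma derives_refl_Imp_l (S G : Ensemble formula) (a c : formula) :
  derives S G (a →H a) -> derives S G ((a →' c) →H (a →' c)).
Proof. intro H. exact (derives_Imp_cong_l c H H). Qed.

Lemma derives_refl_Imp_r (S G : Ensemble formula) (a c : formula) :
  derives S G (c →H c) -> derives S G ((a →' c) →H (a →' c)).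
Proof. intro H. exact (derives_Imp_cong_r a H H). Qed.

Lemma derives_refl_and_self (S G : Ensemble formula) (a : formula) :
  derives S G ((a ∧' a) →H (a ∧' a)).
Proof. apply derives_and_intro; apply derives_and_l. Qed.

Lemma derives_Top (S G : Ensemble formula) : derives S G Top.
Proof. exact (derives_axiom S G A6). Qed.

Lemma derives_refl_Top_ImpH (S G : Ensemble formula) (a : formula) :
  derives S G ((Top →H a) →H (Top →H a)).
Proof. apply derives_refl_Imp_l. apply derives_K. apply derives_Top. Qed.

(** [Top →H a] gives [Top →' (a ∧' a)] by (A5) and (A11), and (A10) then replaces [Top]
    by [a], since [a] and [Top] imply each other under the hypothesis
    [Top →H a]. *)
Lemma derives_Top_ImpH_self (S G : Ensemble formula) (a : formula) :
  derives S G ((Top →H a) →H (a →H a)).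
Proof.
  assert (HTop : derives S G (Top →H Top)).
  { apply derives_K. apply derives_Top. }
  pose proof (derives_refl_Top_ImpH S G a) as HY.
  pose proof (derives_refl_and_self S G a) as Haa.
  assert (HD : derives S G ((Top →' (a ∧' a)) →H (Top →' (a ∧' a)))).
  { exact (derives_refl_Imp_l (a ∧' a) HTop). }
  assert (HYD : derives S G ((Top →H a) →H (Top →' (a ∧' a)))).
  { apply derives_trans_of_refl with (b := Top →H (a ∧' a)); trivial.
    - apply derives_MP_under_of_refl with (b := Top →H a); trivial.
      + apply derives_refl_Top_ImpH.
      + exact (derives_axiom S G (A5 a a Top)).
    - apply (@derives_Imp_cong_r S G (Top ∧' (a ∧' a)) (a ∧' a) Top).
      + apply derives_weaken_l. exact Haa.
      + apply derives_and_intro; trivial.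
        apply derives_K. apply derives_Top. }
  apply (derives_MP_under_of_refl HY (derives_refl_Imp_r a Haa) HYD).
  apply derives_MP_under_of_refl with (b := a →H Top); trivial.
  - apply (derives_refl_Imp_l _ HD).
  - apply derives_K. apply derives_K. apply derives_Top.
  - exact (derives_axiom S G (A10 Top a (a ∧' a))).
Qed.

Lemma derives_refl (S G : Ensemble formula) (a : formula) :
  derives S G (a →H a).
Proof.
  pose proof (derives_refl_Top_ImpH S G a) as HY.
  pose proof (derives_Top_ImpH_self S G a) as HYa.
  assert (HYTop : derives S G ((Top →H a) →H ((Top →H a) ∧' Top))).
  { apply derives_and_intro; [exact HY |]. apply derives_K. apply derives_Top. }
  apply derives_refl_of_equiv with (b := Top →H a).
  - refine (derives_SMP _ (derives_axiom S G (A8 a Top a))).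
    apply derives_and_l.
  - refine (derives_replace_l (derives_and_l S G (Top →H a) Top) HYTop _ _ _).
    + apply derives_uncurry.
      apply derives_trans_of_refl with (b := Top →H a); trivial.
      * exact (derives_refl_of_equiv (derives_and_l _ _ _ _) HYTop).
      * apply derives_refl_Imp_r. apply derives_refl_and_self.
      * apply derives_and_l.
    + apply derives_uncurry. exact HYa.
    + apply derives_uncurry. exact HY.
Qed.

(** * The deduction theorem *)

Lemma derives_monotone (S G G' : Ensemble formula) (f : formula) :
  Included formula G G' -> derives S G f -> derives S G' f.
Proof.
  intros HG Hf. induction Hf as [f Hf | s f Hf | f Hf | f g _ IHf _ IHfg
                                | f g _ IH].
  - exact (derives_axiom S G' Hf).
  - exact (derives_scheme S G' s f Hf).
  - apply derives_hyp. exact (HG f Hf).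
  - exact (derives_SMP IHf IHfg).
  - exact (derives_SCP IH).
Qed.

Lemma derives_discharge (S G : Ensemble formula) (a f : formula) :
  (forall b c : formula,
     derives S (Empty_set formula) ((b →H c) →H (~' c →H ~' b))) ->
  derives S (Add formula G a) f -> derives S G (a →H f).
Proof.
  intros Hcontra Hf.
  induction Hf as [f Hf | s f Hf | f Hf | f g _ IHf _ IHfg | f g _ IH].
  - apply derives_K. exact (derives_axiom S G Hf).
  - apply derives_K. exact (derives_scheme S G s f Hf).
  - destruct Hf as [f Hf | f Hf].
    + apply derives_K. exact (derives_hyp S G f Hf).
    + destruct Hf. apply derives_refl.
  - exact (derives_MP_under_of_refl (derives_refl S G a) (derives_refl S G g)
             IHf IHfg).
  - apply derives_trans_of_refl with (b := f →H g);
      try apply derives_refl; trivial.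
    apply derives_monotone with (G := Empty_set formula); [| apply Hcontra].
    intros x Hx. destruct Hx.
Qed.

Unset Implicit Arguments.

Theorem theorem6p3 (S : Ensemble formula) :
  deduction_property (derives S) ImpH <->
  (forall a b : formula,
     derives S (Empty_set formula) ((a →H b) →H (~' b →H ~' a))).
Proof.
  split.
  - intros HDP a b. apply HDP. apply derives_SCP. apply derives_hyp.
    apply Union_intror. apply In_singleton.
  - intros Hcontra G a b. split.
    + apply derives_discharge. exact Hcontra.
    + intro H. apply derives_SMP with (f := a).
      * apply derives_hyp. apply Union_intror. apply In_singleton.
      * apply derives_monotone with (G := G); [| exact H].
        intros x Hx. apply Union_introl. exact Hx.
Qed.
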